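(* Let $n,m\ge 3$ and let $C_n,C_m$ be cycles on $n$ and $m$ vertices. Let $\Delta$ be the maximum degree of $C_n\times C_m$. Then $\chi''_{\Sigma}(C_n\times C_m)=\Delta+2$.
   Context: All graphs are finite and simple. A proper total $k$-coloring of a graph $G$ assigns to every vertex and every edge a color from $\{1,\dots,k\}$ such that adjacent vertices receive different colors, edges sharing an endpoint receive different colors, and no edge receives the same color as either of its endpoints. For such a coloring $c$ and a vertex $v$, let $f(v)=c(v)+\sum_{e\ni v} c(e)$. The coloring distinguishes adjacent vertices by sums if $f(u)\neq f(v)$ for every edge $uv$. $\chi''_{\Sigma}(G)$ denotes the smallest $k$ such that $G$ has a proper total $k$-coloring distinguishing adjacent vertices by sums. The product $G_1\times G_2$ is the Cartesian product: vertex set $V(G_1)\times V(G_2)$, with $(u_1,u_2)$ adjacent to $(v_1,v_2)$ iff either $u_1=v_1$ and $u_2v_2\in E(G_2)$, or $u_1v_1\in E(G_1)$ and $u_2=v_2$. *)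

(* Defs.v *)
From HB Require Import structures.
From mathcomp Require Import all_boot.

Set Implicit Arguments.
Unset Strict Implicit.
Unset Printing Implicit Defensive.

Record sgraph := SGraph {
  vertex :> finType;
  adj : rel vertex;
  adj_sym : symmetric adj;
  adj_irr : irreflexive adj }.

Definition degree (G : sgraph) (x : G) : nat := #|[set y | adj x y]|.

Definition max_degree (G : sgraph) : nat := \max_(x : G) degree x.

Definition is_edge (G : sgraph) (e : {set G}) : bool :=
  [exists x, exists y, adj x y && (e == [set x; y])].

Definition edge (G : sgraph) : finType := {e : {set G} | is_edge e}.

(* The colors 1, ..., k are represented by 'I_k, the element i standing for
   the color i + 1; see [color]. *)
Definition total_coloring (G : sgraph) (k : nat) : finType :=
  {ffun G + edge G -> 'I_k}.

Section TotalColoring.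
Variables (G : sgraph) (k : nat) (c : total_coloring G k).

Definition color (x : G + edge G) : nat := (c x).+1.

Definition proper_total : bool :=
  [&& [forall x : G, forall y : G,
         adj x y ==> (color (inl x) != color (inl y))],
      [forall e : edge G, forall e' : edge G,
         (e != e') && (val e :&: val e' != set0) ==>
         (color (inr e) != color (inr e'))]
    & [forall x : G, forall e : edge G,
         (x \in val e) ==> (color (inl x) != color (inr e))]].

Definition color_sum (x : G) : nat :=
  color (inl x) + \sum_(e : edge G | x \in val e) color (inr e).

Definition sum_distinguishing : bool :=
  [forall x : G, forall y : G, adj x y ==> (color_sum x != color_sum y)].

End TotalColoring.

Definition nsd_total_colorable (G : sgraph) (k : nat) : bool :=
  [exists c : total_coloring G k, proper_total c && sum_distinguishing c].

(* Vertices get the distinct colors 1, ..., M - 1 and edges distinct multiples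
   of M, so that the sum at a vertex determines its color modulo M. *)
Lemma nsd_total_colorable_ex (G : sgraph) : exists k, nsd_total_colorable G k.
Proof.
pose M := #|G|.+1.
pose f (x : G + edge G) : nat :=
  match x with
  | inl v => enum_rank v
  | inr e => (M * (enum_rank e).+1).-1
  end.
pose K := (\max_x f x).+1.
have fK x : f x < K by rewrite ltnS leq_bigmax.
exists K; apply/existsP; exists [ffun x => Ordinal (fK x)].
set c := finfun _.
have cV v : color c (inl v) = (enum_rank v).+1 by rewrite /color ffunE.
have cE e : color c (inr e) = M * (enum_rank e).+1.
  by rewrite /color ffunE /f -[RHS]prednK.
have ltM (v : G) : (enum_rank v).+1 < M by rewrite /M ltnS ltn_ord.
have injV (x y : G) : adj x y -> (enum_rank x).+1 != (enum_rank y).+1.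
  move=> xy; apply/eqP => -[] /val_inj /enum_rank_inj exy.
  by move: xy; rewrite exy adj_irr.
apply/andP; split.
  apply/and3P; split.
  - apply/forallP => x; apply/forallP => y; apply/implyP => xy.
    by rewrite !cV injV.
  - apply/forallP => e; apply/forallP => e'; apply/implyP => /andP[ne _].
    rewrite !cE eqn_pmul2l //; apply: contra ne => /eqP[] /val_inj.
    by move/enum_rank_inj => ->.
  - apply/forallP => x; apply/forallP => e; apply/implyP => _.
    rewrite cV cE; apply/eqP => E.
    by have := ltM x; rewrite E ltnNge leq_pmulr.
apply/forallP => x; apply/forallP => y; apply/implyP => xy.
have sumM v : color_sum c v %% M = (enum_rank v).+1.
  rewrite /color_sum cV; under eq_bigr do rewrite cE.
  by rewrite -big_distrr /= mulnC addnC modnMDl modn_small.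
by apply/eqP => E; have := injV x y xy; rewrite -!sumM E eqxx.
Qed.

Definition chi_sum_total (G : sgraph) : nat :=
  ex_minn (nsd_total_colorable_ex G).

Section CartesianProduct.
Variables G1 G2 : sgraph.

Definition cart_adj : rel (G1 * G2)%type := fun u v =>
  (u.1 == v.1) && adj u.2 v.2 || adj u.1 v.1 && (u.2 == v.2).

Lemma cart_adj_sym : symmetric cart_adj.
Proof.
move=> u v; rewrite /cart_adj (eq_sym u.1) (eq_sym u.2).
by rewrite (adj_sym u.1) (adj_sym u.2).
Qed.

Lemma cart_adj_irr : irreflexive cart_adj.
Proof. by move=> u; rewrite /cart_adj !adj_irr andbF. Qed.

Definition cart_prod : sgraph := SGraph cart_adj_sym cart_adj_irr.

End CartesianProduct.

Section CycleGraph.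
Variable n : nat.

(* The test i != j only matters for n = 1, where [ordS] has a fixed point. *)
Definition cycle_adj : rel 'I_n := fun i j =>
  (i != j) && ((ordS i == j) || (ordS j == i)).

Lemma cycle_adj_sym : symmetric cycle_adj.
Proof. by move=> i j; rewrite /cycle_adj eq_sym orbC. Qed.

Lemma cycle_adj_irr : irreflexive cycle_adj.
Proof. by move=> i; rewrite /cycle_adj eqxx. Qed.

Definition cycle_graph : sgraph := SGraph cycle_adj_sym cycle_adj_irr.

End CycleGraph.

(* Main.v *)
(** The torus is 4-regular.  With at most 5 colors every vertex would see all
    of them, so all sums would agree.  With 6 colors every vertex misses exactly
    one color, and sums of adjacent vertices differ iff their missing colors do.
    So it suffices to color vertices, edges and "missing colors" such that the
    six colors at a vertex are distinct and the missing colors form a proper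
    vertex coloring.  Every cycle of length at least 3 is a closed walk in the
    digraph [0 -> 1 -> 0], [0 -> 2 -> 3 -> 0], so such a coloring is obtained by
    pulling back one on the product of two copies of this digraph, where only
    finitely many local configurations have to be checked. *)

Require Import Defs.
From mathcomp Require Import all_boot.
From mathcomp Require Import zify.

Set Implicit Arguments.
Unset Strict Implicit.
Unset Printing Implicit Defensive.

Lemma uniq_map_inj (A B : eqType) (f : A -> B) (s : seq A) :
  uniq (map f s) -> {in s &, injective f}.
Proof.
elim: s => //= a s IHs /andP[fa /IHs{}IHs] x y.
rewrite !inE => /predU1P[->|xs] /predU1P[->|ys] // E; last exact: IHs.
  by rewrite E map_f in fa.
by rewrite -E map_f in fa.
Qed.

(** * Edges of a simple graph *)

Lemma eq_set2 (T : finType) (x y a b : T) : [set x; y] = [set a; b] ->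
  (x = a /\ y = b) \/ (x = b /\ y = a).
Proof.
move=> E.
have /set2P xab : x \in [set a; b] by rewrite -E set21.
have /set2P yab : y \in [set a; b] by rewrite -E set22.
have /set2P axy : a \in [set x; y] by rewrite E set21.
have /set2P bxy : b \in [set x; y] by rewrite E set22.
by case: xab yab axy bxy => -> [] -> [] ? [] ?; subst; auto.
Qed.

Lemma set2_inj (T : finType) (x : T) : injective (fun y => [set x; y]).
Proof. by move=> y z /eq_set2 [[_ ->]|[-> ->]]. Qed.

Lemma is_edgeP (G : sgraph) (e : {set G}) :
  reflect (exists x y, adj x y /\ e = [set x; y]) (is_edge e).
Proof.
apply: (iffP existsP) => [[x /existsP[y /andP[xy /eqP ->]]]|[x [y [xy ->]]]].
  by exists x, y.
by exists x; apply/existsP; exists y; rewrite xy eqxx.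
Qed.

(** This trades the subtype [edge G] for neighbors: both the degree count and the sums over incident
    edges become statements about vertices adjacent to [x]. *)
Lemma incident_edges (G : sgraph) (x : G) :
  [set val e | e in [set e : edge G | x \in val e]] =
  [set [set x; y] | y in [set y | adj x y]].
Proof.
apply/setP => e; apply/imsetP/imsetP => [[f + ->]|[y + ->]]; rewrite inE.
  have /is_edgeP[a [b [ab ->]]] := valP f.
  case/set2P => ->; first by exists b; rewrite ?inE.
  by exists a; rewrite ?inE 1?adj_sym // setUC.
move=> xy; have He : is_edge [set x; y] by apply/is_edgeP; exists x, y.
by exists (exist (@is_edge G) [set x; y] He : edge G); rewrite ?inE ?eqxx.
Qed.

Lemma card_incident_edges (G : sgraph) (x : G) :
  #|[set e : edge G | x \in val e]| = degree x.
Proof.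
rewrite -(card_imset _ val_inj) incident_edges card_imset //.
exact: set2_inj.
Qed.

Lemma sum_incident_edges (G : sgraph) (x : G) (F : {set G} -> nat) :
  \sum_(e : edge G | x \in val e) F (val e) =
  \sum_(y | adj x y) F [set x; y].
Proof.
transitivity (\sum_(e in [set e : edge G | x \in val e]) F (val e)).
  by apply: eq_bigl => e; rewrite inE.
rewrite -(big_imset F) /=; last by move=> ? ? _ _; apply: val_inj.
rewrite incident_edges big_imset /=; last by move=> ? ? _ _; apply: set2_inj.
by apply: eq_bigl => y; rewrite inE.
Qed.

(** * Lower bound *)

(** These are the elements whose colors add up to the sum at [x]; any two of them conflict. *)
Definition total_star (G : sgraph) (x : G) : {set G + edge G} :=
  inl x |: [set inr e | e in [set e : edge G | x \in val e]].

Lemma inl_notin_inr (G : sgraph) (x : G) (A : {set edge G}) :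
  inl x \notin ([set inr e | e in A] : {set G + edge G}).
Proof. by apply/imsetP => -[]. Qed.

Lemma inr_inj (A B : Type) : injective (@inr A B).
Proof. by move=> ? ? []. Qed.

Lemma card_total_star (G : sgraph) (x : G) : #|total_star x| = (degree x).+1.
Proof.
rewrite cardsU1 inl_notin_inr card_imset ?card_incident_edges //.
exact: inr_inj.
Qed.

Lemma color_sum_star (G : sgraph) k (c : total_coloring G k) (x : G) :
  color_sum c x = \sum_(i in total_star x) (c i).+1.
Proof.
rewrite big_setU1 ?inl_notin_inr //= big_imset /=; last first.
  by move=> ? ? _ _; apply: inr_inj.
by congr addn; apply: eq_bigl => e; rewrite inE.
Qed.

Lemma proper_total_inj_star (G : sgraph) k (c : total_coloring G k) (x : G) :
  proper_total c -> {in total_star x &, injective c}.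
Proof.
case/and3P => _ /forallP hE /forallP hV.
have neV (e : edge G) : x \in val e -> c (inl x) != c (inr e).
  by move: (hV x) => /forallP/(_ e)/implyP/[apply]; rewrite /color eqSS.
have neE (e e' : edge G) : x \in val e -> x \in val e' ->
    c (inr e) = c (inr e') -> e = e'.
  move=> xe xe' Ec; apply: contraTeq isT => ne.
  move: (hE e) => /forallP/(_ e')/implyP; rewrite ne /color Ec eqxx => -> //.
  by apply/set0Pn; exists x; rewrite inE xe.
move=> i j /setU1P[->|/imsetP[e xe ->]] /setU1P[->|/imsetP[e' xe' ->]] Ec //.
- by rewrite inE in xe'; case/eqP: (neV _ xe').
- by rewrite inE in xe; case/eqP: (neV _ xe).
by rewrite !inE in xe xe'; congr inr; apply: neE.
Qed.

(* With [degree x + 1] colors the star of a vertex uses every color, so all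
   vertices of that degree have the same sum. *)
Lemma nsd_total_colorable_lower (G : sgraph) k (x y : G) :
  adj x y -> degree x = degree y -> nsd_total_colorable G k ->
  degree x + 2 <= k.
Proof.
move=> xy dxy /existsP[c /andP[cP /forallP/(_ x)/forallP/(_ y)/implyP/(_ xy)]].
have card_im z : #|c @: total_star z| = (degree z).+1.
  by rewrite card_in_imset ?card_total_star //; apply: proper_total_inj_star.
apply: contraNT; rewrite -ltnNge => lt_k.
have sumT z : degree z = degree x -> color_sum c z = \sum_(i < k) i.+1.
  move=> dz; rewrite color_sum_star.
  rewrite -(big_imset (fun i : 'I_k => i.+1)) /=; last first.
    exact: proper_total_inj_star.
  suff -> : c @: total_star z = setT by apply: eq_bigl => i; rewrite inE.
  apply/eqP; rewrite eqEcard subsetT cardsT card_ord card_im dz.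
  by move: lt_k; rewrite addn2 ltnS.
by rewrite !sumT.
Qed.

(** * Colorings from functions on vertices and on adjacent pairs *)

(** Edge colors become a symmetric function on ordered adjacent pairs, so constructions can ignore
    the type [edge G]. Values run from 0 to [k], hence [k.+1] colors. *)
Lemma nsd_total_colorable_of_fun (G : sgraph) k (f : G -> nat)
    (g : G -> G -> nat) :
  (forall x, f x <= k) -> (forall x y, adj x y -> g x y <= k) ->
  (forall x y, adj x y -> g x y = g y x) ->
  (forall x y, adj x y -> f x != f y) ->
  (forall x y, adj x y -> f x != g x y) ->
  (forall x y z, adj x y -> adj x z -> g x y = g x z -> y = z) ->
  (forall x y, adj x y -> f x + \sum_(z | adj x z) (g x z).+1 !=
                          f y + \sum_(z | adj y z) (g y z).+1) ->
  nsd_total_colorable G k.+1.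
Proof.
move=> fk gk gC fP fgP gP sP.
(* An orientation of [e] is picked arbitrarily; by [gC] the choice does not matter. The default
   [ord0] is reached only on non-edges. *)
pose h (e : {set G}) : 'I_k.+1 :=
  if [pick p : G * G | adj p.1 p.2 && (e == [set p.1; p.2])] is Some p
  then inord (g p.1 p.2) else ord0.
have hE x y : adj x y -> h [set x; y] = g x y :> nat.
  move=> xy; rewrite /h; case: pickP => [[a b] /= /andP[ab /eqP]|/(_ (x, y))].
    by move=> /eq_set2[[-> ->]|[-> ->]]; rewrite inordK ?ltnS ?gk // gC.
  by rewrite /= xy eqxx.
pose c : total_coloring G k.+1 :=
  [ffun i => match i with inl x => inord (f x) | inr e => h (val e) end].
have cV x : color c (inl x) = (f x).+1 by rewrite /color ffunE inordK ?ltnS.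
have cE e : color c (inr e) = (h (val e)).+1 by rewrite /color ffunE.
have edge_at x (e : edge G) : x \in val e ->
    exists2 y, adj x y & val e = [set x; y].
  move=> xe; have : val e \in [set val e | e in [set e : edge G | x \in val e]].
    by apply/imsetP; exists e; rewrite ?inE.
  by rewrite incident_edges => /imsetP[y]; rewrite inE => ? ?; exists y.
apply/existsP; exists c; apply/andP; split; [apply/and3P; split|].
- apply/forallP => x; apply/forallP => y; apply/implyP => xy.
  by rewrite !cV eqSS fP.
- apply/forallP => e; apply/forallP => e'; apply/implyP => /andP[ne].
  case/set0Pn => x; rewrite inE => /andP[/edge_at[y xy Ee] /edge_at[z xz Ee']].
  rewrite !cE eqSS Ee Ee' !hE //; apply: contra ne => /eqP/gP Eyz.
  by apply/eqP/val_inj; rewrite Ee Ee' Eyz.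
- apply/forallP => x; apply/forallP => e; apply/implyP => /edge_at[y xy Ee].
  by rewrite cV cE eqSS Ee hE // fgP.
have sumE x : color_sum c x = (f x + \sum_(z | adj x z) (g x z).+1).+1.
  rewrite /color_sum cV addSn; congr (_ + _).+1.
  under eq_bigr do rewrite cE.
  rewrite (sum_incident_edges x (fun e => (h e).+1)).
  by apply: eq_bigr => y xy; rewrite hE.
apply/forallP => x; apply/forallP => y; apply/implyP => xy.
by rewrite !sumE eqSS sP.
Qed.

(** * The torus *)

Lemma ordS_neq n (i : 'I_n) : 1 < n -> ordS i != i.
Proof.
move=> n1; apply/eqP => /(congr1 val) /=.
have := ltn_ord i; rewrite leq_eqVlt => /predU1P[En|lt_i].
  by rewrite En modnn; lia.
by rewrite modn_small //; lia.
Qed.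

(** Applying [ordS] to both sides leaves [i + 2 = i] modulo [n]; the cases are no wrap-around, wrap
    at the first step, and wrap at the second. *)
Lemma ordS_neq_pred n (i : 'I_n) : 2 < n -> ordS i != ord_pred i.
Proof.
move=> n2; apply/eqP => /(congr1 (fun j => val (ordS j))).
rewrite ord_predK /=; have lt_i := ltn_ord i.
case: (ltngtP i.+2 n) => [lt2|gt2|E2].
- by rewrite (modn_small (ltnW lt2)) (modn_small lt2); lia.
- have E : i.+1 = n by lia.
  by rewrite E modnn modn_small; lia.
by rewrite (@modn_small i.+1) ?E2 ?modnn; lia.
Qed.

Lemma cycle_adjE n (i j : cycle_graph n) :
  1 < n -> adj i j = (j == ordS i) || (j == ord_pred i).
Proof.
move=> n1; have eqSP := can2_eq (@ordSK n) (@ord_predK n).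
rewrite /adj /= /cycle_adj (eqSP j) (eq_sym j (ordS i)).
case: (altP (i =P j)) => [<-|//].
by rewrite -eqSP (negbTE (ordS_neq i n1)).
Qed.

Section Torus.
Variables (n m : nat) (hn : 2 < n) (hm : 2 < m).

Let T := cart_prod (cycle_graph n) (cycle_graph m).
Implicit Types x y : T.

Definition east x : T := (ordS x.1, x.2).
Definition west x : T := (ord_pred x.1, x.2).
Definition north x : T := (x.1, ordS x.2).
Definition south x : T := (x.1, ord_pred x.2).

Lemma eastK : cancel east west.
Proof. by case=> i j; rewrite /east /west /= ordSK. Qed.

Lemma westK : cancel west east.
Proof. by case=> i j; rewrite /east /west /= ord_predK. Qed.

Lemma northK : cancel north south.
Proof. by case=> i j; rewrite /north /south /= ordSK. Qed.

Lemma southK : cancel south north.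
Proof. by case=> i j; rewrite /north /south /= ord_predK. Qed.

Definition neighbors x : seq T := [:: east x; north x; west x; south x].

Lemma torus_adjE x y : adj x y = (y \in neighbors x).
Proof.
rewrite /adj /= /cart_adj !cycle_adjE 1?ltnW // !inE.
case: x y => [i j] [i' j']; rewrite /east /west /north /south -!pair_eqE /=.
rewrite /pair_eq /= (eq_sym i) (eq_sym j).
by case: (i' == i); case: (j' == j); rewrite ?andbT ?andbF ?orbF ?orbT //=;
  case: (_ == _); case: (_ == _); rewrite ?orbT ?orbF.
Qed.

(** Lengths above 2 keep opposite neighbors apart, which makes the torus 4-regular. *)
Lemma neighbors_uniq x : uniq (neighbors x).
Proof.
case: x => i j; rewrite /neighbors /= !inE /east /west /north /south -!pair_eqE.
have Si := ordS_neq i (ltnW hn); have Sj := ordS_neq j (ltnW hm).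
have Pi : ord_pred i != i.
  by rewrite (can2_eq (@ord_predK _) (@ordSK _)) eq_sym.
have Pj : ord_pred j != j.
  by rewrite (can2_eq (@ord_predK _) (@ordSK _)) eq_sym.
rewrite /pair_eq /= (negbTE Si) (negbTE (ordS_neq_pred i hn)) (eq_sym i).
by rewrite (negbTE Pi) (negbTE (ordS_neq_pred j hm)) andbF.
Qed.

Lemma degree_torus x : degree x = 4.
Proof.
rewrite -[RHS](card_uniqP (neighbors_uniq x)) /degree -[RHS]cardsE.
by congr #|pred_of_set _|; apply/setP => y; rewrite !inE torus_adjE !inE.
Qed.

(** Every edge leaves one of its endpoints to the east or to the north. *)
Lemma torus_adj_ind (P : T -> T -> Prop) :
  (forall x y, P x y -> P y x) ->
  (forall x, P x (east x)) -> (forall x, P x (north x)) ->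
  forall x y, adj x y -> P x y.
Proof.
move=> sym PE PN x y; rewrite torus_adjE !inE.
case/or4P => /eqP -> //; apply: sym.
  by rewrite -{2}(westK x).
by rewrite -{2}(southK x).
Qed.

Definition edge_fun (h v : T -> nat) x y : nat :=
  if y == east x then h x else if y == north x then v x
  else if y == west x then h y else v y.

Lemma edge_fun_neighbors h v x :
  map (edge_fun h v x) (neighbors x) = [:: h x; v x; h (west x); v (south x)].
Proof.
have /= := neighbors_uniq x; rewrite !inE !negb_or.
case/and4P => /and3P[EN EW ES] /andP[NW NS] WS _.
rewrite /neighbors /= /edge_fun !eqxx ![_ == east x]eq_sym.
rewrite (negbTE EN) (negbTE EW) (negbTE ES) ![_ == north x]eq_sym.
by rewrite (negbTE NW) (negbTE NS) [_ == west x]eq_sym (negbTE WS).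
Qed.

Lemma edge_funC h v x y : adj x y -> edge_fun h v x y = edge_fun h v y x.
Proof.
apply: (@torus_adj_ind (fun x y => edge_fun h v x y = edge_fun h v y x)).
- by move=> {}x {}y.
- move=> {}x.
  (* Seen from [east x], this edge is the west one, with color [h (west (east x))]. *)
  have [_ _ + _] := edge_fun_neighbors h v (east x); rewrite eastK => ->.
  by have [-> _ _ _] := edge_fun_neighbors h v x.
move=> {}x.
have [_ _ _] := edge_fun_neighbors h v (north x); rewrite northK => ->.
by have [_ -> _ _] := edge_fun_neighbors h v x.
Qed.

(* [f], [h], [v] are the colors of the vertices and of the edges leaving them
   east and north; [g] is the color missing at a vertex. *)
Lemma torus_nsd_colorable (f g h v : T -> nat) :
  (forall x, perm_eq (iota 0 6)
               [:: f x; g x; h x; v x; h (west x); v (south x)]) ->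
  (forall x, [&& f x != f (east x), f x != f (north x),
                 g x != g (east x) & g x != g (north x)]) ->
  nsd_total_colorable T 6.
Proof.
move=> star_perm proper.
have star_uniq x : uniq (f x :: g x :: map (edge_fun h v x) (neighbors x)).
  by rewrite edge_fun_neighbors -(perm_uniq (star_perm x)).
have star_lt x z : z \in f x :: g x :: map (edge_fun h v x) (neighbors x) ->
    z <= 5.
  rewrite edge_fun_neighbors -(perm_mem (star_perm x)) mem_iota; lia.
(* Here 19 is 0 + 1 + ... + 5 = 15 plus one for each of the four successors. Thus equal sums would
   force equal missing colors. *)
have sumE x :
    f x + \sum_(z | adj x z) (edge_fun h v x z).+1 + g x = 19.
  rewrite (eq_bigl (mem (neighbors x))); last by move=> y; rewrite torus_adjE.
  rewrite -big_uniq ?neighbors_uniq //=.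
  rewrite -(big_map (edge_fun h v x) predT succn) edge_fun_neighbors.
  rewrite !big_cons big_nil; have := perm_sumn (star_perm x) => /=; lia.
apply: (@nsd_total_colorable_of_fun T 5 f (edge_fun h v)).
- by move=> x; apply: (star_lt x); rewrite inE eqxx.
- move=> x y; rewrite torus_adjE => xy; apply: (star_lt x).
  by rewrite 2!in_cons map_f ?orbT.
- exact: edge_funC.
- apply: torus_adj_ind => [x y|x|x]; first by rewrite eq_sym.
    by case/and4P: (proper x).
  by case/and4P: (proper x).
- move=> x y; rewrite torus_adjE => xy; have /andP[+ _] := star_uniq x.
  by apply: contraNneq => ->; rewrite in_cons map_f ?orbT.
- move=> x y z; rewrite !torus_adjE => xy xz.
  have u : uniq (map (edge_fun h v x) (neighbors x)).
    by case/and3P: (star_uniq x).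
  exact: (uniq_map_inj u xy xz).
have neq_sum x y : g x != g y ->
    f x + \sum_(z | adj x z) (edge_fun h v x z).+1 !=
    f y + \sum_(z | adj y z) (edge_fun h v y z).+1.
  by apply: contraNneq => E; have := sumE x; rewrite E -(sumE y); lia.
move=> x y xy; apply: neq_sum; move: x y xy.
apply: torus_adj_ind => [x y|x|x]; first by rewrite eq_sym.
  by case/and4P: (proper x).
by case/and4P: (proper x).
Qed.

End Torus.

(** * Closed walks in a small digraph and the finite check *)

Definition arcs : seq (nat * nat) :=
  [:: (0, 1); (1, 0); (0, 2); (2, 3); (3, 0)].

(** For even [n] the walk is 0, 1, 0, 1, ...; for odd [n] one triangle 0, 2, 3 fixes the parity and
    is followed by 0, 1, 0, 1, ... *)
Definition cycle_walk n (i : nat) : nat :=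
  if odd n && (i < 3) then nth 0 [:: 0; 2; 3] i else odd n (+) odd i.

Lemma cycle_walk_arc n (i : 'I_n) :
  2 < n -> (cycle_walk n i, cycle_walk n (ordS i)) \in arcs.
Proof.
case: i => i /= + n2; rewrite leq_eqVlt => /predU1P[En|lt_i].
  (* At the wrap-around the last state is 1, or 3 when [n = 3]; both have an arc to 0. *)
  rewrite En modnn -{n}En in n2 *.
  by case: i n2 => [|[|[|i]]] //= _; rewrite /cycle_walk /=; case: (odd i).
rewrite modn_small // /cycle_walk; case: (odd n) => /=.
  by case: i {lt_i} => [|[|[|i]]] //=; case: (odd i).
by case: (odd i).
Qed.

Definition entry (t : seq (seq nat)) a b := nth 0 (nth [::] t a) b.

(* The four tables were found by computer search. *)
Definition vertex_table := entry
  [:: [:: 1; 0; 0; 2]; [:: 5; 3; 2; 3]; [:: 2; 3; 4; 5]; [:: 0; 4; 2; 4]].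

Definition missing_table := entry
  [:: [:: 0; 1; 2; 5]; [:: 3; 5; 1; 2]; [:: 3; 2; 5; 1]; [:: 4; 0; 1; 2]].

Definition east_table := entry
  [:: [:: 4; 4; 3; 4]; [:: 2; 2; 4; 0]; [:: 5; 5; 0; 3]; [:: 2; 2; 4; 0]].

Definition north_table := entry
  [:: [:: 5; 3; 1; 3]; [:: 0; 1; 5; 1]; [:: 1; 0; 2; 0]; [:: 3; 1; 5; 1]].

(** The constraints at one torus vertex, given three consecutive states in each factor; [a0] and
    [b0] locate the colors of the edges arriving from west and south. *)
Definition table_ok (a0 a a1 b0 b b1 : nat) : bool :=
  [&& perm_eq (iota 0 6)
        [:: vertex_table a b; missing_table a b; east_table a b;
            north_table a b; east_table a0 b; north_table a b0],
      vertex_table a b != vertex_table a1 b,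
      vertex_table a b != vertex_table a b1,
      missing_table a b != missing_table a1 b
    & missing_table a b != missing_table a b1].

Lemma tables_ok a0 a a1 b0 b b1 :
  (a0, a) \in arcs -> (a, a1) \in arcs ->
  (b0, b) \in arcs -> (b, b1) \in arcs ->
  table_ok a0 a a1 b0 b b1.
Proof.
(* The pairs [p], [q] and [r], [s] range over composable arcs in the first and second factor. *)
have check : all (fun p => all (fun q => (p.2 == q.1) ==>
    all (fun r => all (fun s => (r.2 == s.1) ==>
      table_ok p.1 p.2 q.2 r.1 r.2 s.2) arcs) arcs) arcs) arcs.
  by vm_compute.
move=> pA qA rA sA.
have /allP/(_ _ qA) := allP check _ pA; rewrite eqxx => check_b.
by have /allP/(_ _ sA) := allP check_b _ rA; rewrite eqxx.
Qed.

Lemma torus_nsd_colorable_6 n m : 2 < n -> 2 < m ->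
  nsd_total_colorable (cart_prod (cycle_graph n) (cycle_graph m)) 6.
Proof.
move=> hn hm.
pose on t (x : cart_prod (cycle_graph n) (cycle_graph m)) : nat :=
  t (cycle_walk n x.1) (cycle_walk m x.2).
have ok (x : cart_prod (cycle_graph n) (cycle_graph m)) :
    table_ok (cycle_walk n (ord_pred x.1)) (cycle_walk n x.1)
             (cycle_walk n (ordS x.1))
             (cycle_walk m (ord_pred x.2)) (cycle_walk m x.2)
             (cycle_walk m (ordS x.2)).
  (* The arc entering a state is the one leaving its predecessor. *)
  have En := cycle_walk_arc (ord_pred x.1) hn.
  have Em := cycle_walk_arc (ord_pred x.2) hm.
  rewrite ord_predK in En; rewrite ord_predK in Em.
  by apply: tables_ok => //; apply: cycle_walk_arc.
apply: (@torus_nsd_colorable n m hn hm (on vertex_table) (on missing_table)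
          (on east_table) (on north_table)) => x.
  by case/andP: (ok x).
by case/andP: (ok x).
Qed.

Theorem theorem4p8 (n m : nat) (hn : 3 <= n) (hm : 3 <= m) :
  chi_sum_total (cart_prod (cycle_graph n) (cycle_graph m)) =
  max_degree (cart_prod (cycle_graph n) (cycle_graph m)) + 2.
Proof.
(* The vertex (0, 0) witnesses the maximum degree and, with its east neighbor, the lower bound. *)
pose x : cart_prod (cycle_graph n) (cycle_graph m) :=
  (Ordinal (ltnW (ltnW hn)), Ordinal (ltnW (ltnW hm))).
have -> : max_degree (cart_prod (cycle_graph n) (cycle_graph m)) = 4.
  apply/eqP; rewrite eqn_leq -{2}(degree_torus hn hm x) leq_bigmax andbT.
  by apply/bigmax_leqP => y _; rewrite degree_torus.
rewrite /chi_sum_total; case: ex_minnP => k k_col k_min.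
apply/eqP; rewrite eqn_leq k_min ?torus_nsd_colorable_6 //=.
rewrite -(degree_torus hn hm x).
apply: (nsd_total_colorable_lower (y := east x)) => //.
  by rewrite torus_adjE ?inE ?eqxx.
by rewrite !degree_torus.
Qed.
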